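(* Let $l\ge 1$ and suppose that a group $G$ acts isometrically and with the contracting property on each of finitely many geodesic metric spaces $X_1,\ldots,X_l$. Then the set $$\mathcal{SC}(G)=\{g\in G:\ g \text{ is a contracting element on } X_i \text{ for every } 1\le i\le l\}$$ is not empty and contains an infinite independent subset. Moreover, if $G$ is generated by a finite set $S$, then there exists a constant $c\in(0,1)$ (depending on $S$, the group and the actions being fixed) such that $$\frac{\sharp\,(S^{\le n}\cap \mathcal{SC}(G))}{\sharp\, S^{\le n}}>c$$ for all sufficiently large $n$.
   Context: Let $(X,d)$ be a geodesic metric space. For $Z\subseteq X$, $N_C(Z)$ is the closed $C$-neighborhood. For a closed subset $Y\subseteq X$ put $\pi_Y(x)=\{y\in Y: d(x,y)=d(x,Y)\}$ and $\pi_Y(B)=\bigcup_{x\in B}\pi_Y(x)$. A closed subset $Y$ is $C$-contracting ($C\ge 0$) if every geodesic segment $\alpha$ in $X$ with $\alpha\cap N_C(Y)=\emptyset$ satisfies $\mathrm{diam}(\pi_Y(\alpha))\le C$; $Y$ is contracting if it is $C$-contracting for some $C\ge 0$. Let $G$ act isometrically on $X$ with basepoint $o\in X$. An element $h\in G$ is a contracting element (on $X$) if $\langle h\rangle\cdot o$ is a contracting subset of $X$ and $\mathbb{Z}\to X$, $n\mapsto h^n o$, is a quasi-isometric embedding. Two contracting elements $g,h\in G$ are weakly-independent (on $X$) if there is a function $\mathcal{R}:[0,+\infty)\to[0,+\infty)$ such that $\mathrm{diam}(N_r(\langle g\rangle o)\cap N_r(\langle h\rangle o))\le \mathcal{R}(r)$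 for all $r\ge 0$. The action $G\curvearrowright X$ has the contracting property if $G$ contains two weakly-independent contracting elements on $X$. A subset $F\subseteq \mathcal{SC}(G)$ is independent if any two distinct elements of $F$ are weakly-independent on $X_i$ for every $1\le i\le l$. $S^{\le n}$ is the set of elements of $G$ that can be written as a product of at most $n$ letters in $S\cup S^{-1}$; $\sharp$ denotes cardinality. *)

(* Defs.v *)
From HB Require Import structures.
From mathcomp Require Import all_boot all_order all_algebra.
From mathcomp Require Import all_classical all_reals all_analysis.

Set Implicit Arguments.
Unset Strict Implicit.
Unset Printing Implicit Defensive.

Import Order.TTheory GRing.Theory Num.Theory.

Local Open Scope classical_set_scope.
Local Open Scope ring_scope.

Section metric.
Context {R : realType} {X : metricType R}.
Implicit Types (x y : X) (Y Z A B : set X) (C : R).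

(* With this, [edist_inf Y x] is the infimum of the distances [mdist x y] for
   [y] in [Y], with value [+oo] when [Y] is empty. *)
Lemma edist_mdist x y : edist (x, y) = (mdist x y)%:E.
Proof.
apply/eqP; rewrite eq_le; apply/andP; split.
  apply/lee_addgt0Pr => e e0; apply: ereal_inf_lbound.
  exists (mdist x y + e); last by rewrite EFinD.
  by split; [rewrite ltr_wpDl ?mdist_ge0|rewrite ballEmdist/= ltrDl].
apply: le_ereal_inf_tmp => _ [r [_ xyr] <-].
by move: xyr; rewrite ballEmdist/= lee_fin => /ltW.
Qed.

(* The point [0] only matters for [A = set0], whose diameter is thus [0]. *)
Definition diam A : \bar R :=
  ereal_sup (0%E |` [set (mdist p.1 p.2)%:E | p in A `*` A]).

Definition closed_nbhd C Z : set X := [set x | (edist_inf Z x <= C%:E)%E].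

Definition geodesic (L : R) (gamma : R -> X) :=
  0 <= L /\
  {in `[0, L] &, forall s t, mdist (gamma s) (gamma t) = `|s - t|}.

Definition geodesic_segment (alpha : set X) :=
  exists L gamma, geodesic L gamma /\ alpha = gamma @` `[0, L].

Definition proj_pt Y x : set X :=
  [set y | Y y /\ (mdist x y)%:E = edist_inf Y x].

Definition proj Y B : set X := \bigcup_(x in B) proj_pt Y x.

Definition C_contracting C Y :=
  [/\ closed Y, 0 <= C &
    forall alpha, geodesic_segment alpha ->
      alpha `&` closed_nbhd C Y = set0 -> (diam (proj Y alpha) <= C%:E)%E].

Definition contracting Y := exists C, C_contracting C Y.

Definition qi_embedding_int (f : int -> X) :=
  exists lambda c : R, [/\ 1 <= lambda, 0 <= c &
    forall m n : int,
      lambda^-1 * `|m - n|%:~R - c <= mdist (f m) (f n)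
                                   <= lambda * `|m - n|%:~R + c].

End metric.

Definition geodesic_space {R : realType} (X : metricType R) :=
  forall x y : X, exists L gamma,
    [/\ geodesic L gamma, gamma 0 = x & gamma L = y].

Definition zexpg {G : groupType} (g : G) (n : int) : G :=
  match n with Posz k => (g ^+ k)%g | Negz k => (g ^- k.+1)%g end.

Section action.
Context {R : realType} {G : groupType} {X : metricType R}.
Variables (act : G -> X -> X) (o : X).
Implicit Types g h : G.

Definition isometric_action :=
  [/\ forall x, act 1%g x = x,
      forall g h x, act (g * h)%g x = act g (act h x) &
      forall g x y, mdist (act g x) (act g y) = mdist x y].

Definition cycle_orbit h : set X := range (fun n : int => act (zexpg h n) o).

Definition contracting_element h :=
  contracting (cycle_orbit h) /\
  qi_embedding_int (fun n : int => act (zexpg h n) o).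

Definition weakly_independent g h :=
  exists2 rho : R -> R, (forall r, 0 <= r -> 0 <= rho r) &
    forall r, 0 <= r ->
      (diam (closed_nbhd r (cycle_orbit g) `&` closed_nbhd r (cycle_orbit h))
         <= (rho r)%:E)%E.

Definition contracting_property :=
  exists g h, [/\ contracting_element g, contracting_element h &
                  weakly_independent g h].

End action.

Section simultaneous.
Context {R : realType} {G : groupType} {l : nat} {X : 'I_l -> metricType R}.
Variables (act : forall i, G -> X i -> X i) (o : forall i, X i).

Definition SC : set G :=
  [set g | forall i, contracting_element (@act i) (o i) g].

Definition independent (F : set G) :=
  F `<=` SC /\
  forall g h, F g -> F h -> g <> h ->
    forall i, weakly_independent (@act i) (o i) g h.

End simultaneous.

Section words.
Context {G : groupType}.
Implicit Types S : set G.

Definition generates S :=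
  smallest (fun H : set G => group_closed [in H]) S = setT.

Definition letters S : set G := S `|` [set x^-1%g | x in S].

Definition word_ball S (n : nat) : set G :=
  [set g | exists w : seq G, [/\ (size w <= n)%N,
    forall x, x \in w -> letters S x & g = (\prod_(x <- w) x)%g]].

(* Hence [fset_set (word_ball S n `&` A)] has the intended elements. *)
Lemma finite_word_ball S n : finite_set S -> finite_set (word_ball S n).
Proof.
move=> fS; elim: n => [|n IHn].
  apply: (@sub_finite_set _ _ [set 1%g]); last exact: finite_set1.
  by move=> g [[|x w] [sw _ ->]]; [rewrite /= big_nil|].
apply: (@sub_finite_set _ _
  (1%g |` [set (x * y)%g | x in letters S & y in word_ball S n])).
  move=> g [[|x w] [sw lw ->]]; first by left; rewrite big_nil.
  right; exists x; first by apply: lw; rewrite mem_head.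
  exists (\prod_(y <- w) y)%g; last by rewrite big_cons.
  by exists w; split => // y yw; apply: lw; rewrite inE yw orbT.
rewrite finite_setU; split; first exact: finite_set1.
apply: finite_image2 => //.
by rewrite finite_setU; split => //; exact: finite_image.
Qed.

End words.

(* Main.v *)
(** Call a set [A] of group elements small if, for every [k], there is a finite
    list [P] such that, for all [a] and [b], at most one element [p] of [P] out
    of [k] satisfies [A (a * p * b)].  Small sets are closed under finite unions
    (multiply the lists), so bad events coming from several actions can be
    handled one action at a time, however the actions interact.

    For a single action with weakly independent contracting elements [g] and
    [h], let [u i] be a high power of [g] depending on [i], and let [P] be the
    list of the elements [u i * h ^+ N * (u j)^-1].  By the Behrstock inequality
    a translate of the orbit of a cyclic group generated by a contracting
    element projects far from [u i o] on the axis [u i <h> o] for at most two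
    indices [i], one for each of its ends.  Thus, apart from linearly many bad
    pairs, [a * p * b] is conjugate to [h ^+ N * w] where the sets [w <h> o] and
    [w^-1 <h> o] both project near [o] on [<h> o].  For [f := h ^+ N * w], the
    translates of [<h> o] by the powers of [f] then form a chain along which
    projections propagate, and [f] is contracting.  Similarly [s] and its
    conjugate by [a * p * b] have separated projections on a translate of
    [<h> o], and are weakly independent.

    So the elements that are not simultaneously contracting form a small set,
    and some finite list [P] meets each translate of [SC]: this bounds the
    density from below.  An infinite independent set is obtained by choosing
    successive conjugates of one element of [SC] outside small sets. *)

Require Import Defs.
From HB Require Import structures.
From mathcomp Require Import all_boot all_order all_algebra finmap.
From mathcomp Require Import all_classical all_reals all_analysis.
From mathcomp Require Import lra zify.

Set Implicit Arguments.
Unset Strict Implicit.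
Unset Printing Implicit Defensive.

Import Order.TTheory GRing.Theory Num.Theory.

Local Open Scope classical_set_scope.
Local Open Scope ring_scope.

(** * Contracting sets *)

Section Contraction.
Context {R : realType} {X : metricType R}.
Implicit Types (x y z p q : X) (Y Z : set X) (C L : R) (c : R -> X).

Definition nearest Y x y := Y y /\ forall y', Y y' -> mdist x y <= mdist x y'.

Definition proximinal Y := forall x, exists y, nearest Y x y.

(** Pairs of nearest points replace the diameter of a projection, so that no extended reals enter
    the geometry; [contractingP] makes the link. *)
Definition contracts C Y := forall L c, geodesic L c ->
  (forall t y, 0 <= t <= L -> Y y -> C < mdist (c t) y) ->
  forall s t p q, 0 <= s <= L -> 0 <= t <= L ->
    nearest Y (c s) p -> nearest Y (c t) q -> mdist p q <= C.

(* [1 <= C] lets multiples of [C] absorb additive constants.  Nearest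
   points need not exist in a closed subset of a space that is not proper. *)
Definition contracting_set C Y := [/\ 1 <= C, proximinal Y & contracts C Y].

Lemma mdistD y x z : mdist x z <= mdist x y + mdist y z.
Proof. exact: metric_triangle. Qed.

Lemma geodesicP L c s t : geodesic L c -> 0 <= s <= L -> 0 <= t <= L ->
  mdist (c s) (c t) = `|s - t|.
Proof. by move=> [_ h] s0 t0; apply: h; rewrite in_itv. Qed.

Lemma nearest_self Y y p : Y y -> nearest Y y p -> p = y.
Proof.
move=> Yy [_ /(_ _ Yy)]; rewrite mdistxx => h; apply/esym/mdist_positivity.
by apply/eqP; rewrite eq_le h mdist_ge0.
Qed.

Lemma subgeodesic L c s t : geodesic L c -> 0 <= s <= L -> 0 <= t <= L ->
  exists c', [/\ geodesic `|s - t| c', c' 0 = c s, c' `|s - t| = c t &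
    forall r, 0 <= r <= `|s - t| -> exists2 u, 0 <= u <= L & c' r = c u].
Proof.
move=> gc s0 t0.
have [st|ts] := leP s t.
  have e : `|s - t| = t - s by rewrite distrC ger0_norm ?subr_ge0.
  rewrite e; exists (fun r => c (s + r)); split.
  - split; first by rewrite subr_ge0.
    move=> a b; rewrite !in_itv/= => a0 b0.
    rewrite (geodesicP gc); [|lra|lra].
    by congr `|_|; lra.
  - by rewrite addr0.
  - by congr c; lra.
  - by move=> r r0; exists (s + r) => //; lra.
have e : `|s - t| = s - t by rewrite ger0_norm ?subr_ge0// ltW.
rewrite e; exists (fun r => c (s - r)); split.
- split; first by rewrite subr_ge0 ltW.
  move=> a b; rewrite !in_itv/= => a0 b0.
  rewrite (geodesicP gc); [|lra|lra].
  by rewrite distrC; congr `|_|; lra.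
- by rewrite subr0.
- by congr c; lra.
- by move=> r r0; exists (s - r) => //; lra.
Qed.

Lemma contractsW C C' Y : C <= C' -> contracts C Y -> contracts C' Y.
Proof.
move=> CC cY L c gc far s t p q s0 t0 np nq; apply: (le_trans _ CC).
by apply: (cY L c gc _ s t) => // r y r0 Yy; apply: le_lt_trans (far _ _ r0 Yy).
Qed.

Lemma contracting_setW C C' Y :
  C <= C' -> contracting_set C Y -> contracting_set C' Y.
Proof.
by move=> CC [C1 pY cY]; split=> //; [exact: le_trans CC|exact: contractsW cY].
Qed.

Lemma contracts_dicho C Y L c : geodesic L c -> contracts C Y ->
  (exists t y, [/\ 0 <= t <= L, Y y & mdist (c t) y <= C]) \/
  forall s t p q, 0 <= s <= L -> 0 <= t <= L ->
    nearest Y (c s) p -> nearest Y (c t) q -> mdist p q <= C.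
Proof.
move=> gc cY; have [h|h] := pselect (exists t y,
  [/\ 0 <= t <= L, Y y & mdist (c t) y <= C]); first by left.
right; apply: (cY L c gc) => t y t0 Yy; rewrite ltNge; apply/negP => le.
by apply: h; exists t, y.
Qed.

Hypothesis Xgeo : geodesic_space X.

Lemma geodesic_between x y :
  exists c, [/\ geodesic (mdist x y) c, c 0 = x & c (mdist x y) = y].
Proof.
have [L [c [gc c0 cL]]] := Xgeo x y; exists c.
have L0 : 0 <= L by case: gc.
suff -> : mdist x y = L by [].
by rewrite -c0 -cL (geodesicP gc) ?lexx ?L0//; rewrite sub0r normrN ger0_norm.
Qed.

Lemma mdist_split x y c t : geodesic (mdist x y) c -> c 0 = x ->
  c (mdist x y) = y -> 0 <= t <= mdist x y ->
  mdist x y = mdist x (c t) + mdist (c t) y.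
Proof.
move=> gc c0 cL t0; have d0 := mdist_ge0 x y.
rewrite -{2}c0 -{2}cL !(geodesicP gc)//; try lra.
rewrite sub0r normrN ger0_norm; last lra.
by rewrite distrC ger0_norm; lra.
Qed.

(** Either the geodesic from [x] to [x'] avoids [Y] and contraction applies, or it passes within [C]
    of [Y], which bounds the distances of both ends to [Y]. *)
Lemma nearest_lip C Y x x' p p' : contracting_set C Y -> nearest Y x p ->
  nearest Y x' p' -> mdist p p' <= 2 * mdist x x' + 2 * C.
Proof.
move=> [C1 _ cY] np np'; have d0 := mdist_ge0 x x'.
have [c [gc c0 cL]] := geodesic_between x x'.
have [[t [y [t0 Yy ty]]]|h] := contracts_dicho gc cY; last first.
  have := h 0 (mdist x x') p p'; rewrite c0 cL => /(_ _ _ np np') => H.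
  have : mdist p p' <= C by apply: H; lra.
  lra.
have e := mdist_split gc c0 cL t0.
have h1 := np.2 _ Yy; have h2 := np'.2 _ Yy.
have := mdistD (c t) x y; have := mdistD (c t) x' y.
have := mdistD x p p'; have := mdistD x' x p'.
by rewrite (metric_sym p x) (metric_sym x' (c t)); lra.
Qed.

Lemma enter_near C Y L c p t y : contracting_set C Y -> geodesic L c ->
  nearest Y (c 0) p -> 0 <= t <= L -> Y y -> mdist (c t) y <= C ->
  exists2 u, 0 <= u <= L & mdist (c u) p <= 8 * C.
Proof.
move=> cs gc np t0 Yy ty; have [C1 pY cY] := cs.
pose E := [set u | 0 <= u <= L /\ exists2 y, Y y & mdist (c u) y <= C].
have iE : has_inf E.
  by split; [exists t; split=> //; exists y|exists 0 => u [/andP[]]].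
have [u [u0 [v Yv uv]] ult] := inf_adherent (ltr01 : 0 < 1 :> R) iE.
have low w : 0 <= w <= L -> w < inf E -> forall y, Y y -> C < mdist (c w) y.
  move=> w0 wE y' Yy'; rewrite ltNge; apply/negP => h.
  by have := ge_inf iE.2 (conj w0 (ex_intro2 _ _ y' Yy' h)); rewrite leNgt wE.
have uE : inf E <= u by apply: (ge_inf iE.2); split=> //; exists v.
have [r nr] := pY (c u).
have ru : mdist (c u) r <= C by apply: le_trans uv; apply: nr.2.
exists u => //.
suff : mdist p r <= 7 * C.
  by have := mdistD r (c u) p; rewrite (metric_sym r p); lra.
have [sE|Es] := leP (inf E) 1.
  have := nearest_lip cs np nr; rewrite (geodesicP gc); [|lra|lra].
  by rewrite sub0r normrN ger0_norm; lra.
(* The infimum of entry times need not be attained. Contraction applies up to one unit before it,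
   and [u] is less than one unit after it, so [nearest_lip] gives [4 + 2 * C <= 6 * C] from [s] to
   [u]. *)
pose s := inf E - 1; have s0 : 0 <= s <= L by rewrite /s; lra.
have [q nq] := pY (c s).
have := nearest_lip cs nq nr; rewrite (geodesicP gc)//.
rewrite distrC ger0_norm; last by rewrite /s; lra.
have [c' [gc' e0 eL im]] := @subgeodesic _ _ 0 s gc (ltac:(lra)) s0.
have e : `|0 - s| = s by rewrite sub0r normrN ger0_norm; lra.
rewrite e in gc' eL im.
have : mdist p q <= C.
  apply: (cY _ _ gc' _ 0 s); rewrite ?e0 ?eL //; try lra.
  move=> r' y' r0' Yy'.
  have gw := geodesicP gc'.
  rewrite ltNge; apply/negP => h.
  have [w w0 cw] := im _ r0'.
  have ws : w = r'.
    have := gw 0 r' (ltac:(lra)) r0'; rewrite cw e0 (geodesicP gc)//; try lra.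
    by rewrite !sub0r !normrN !ger0_norm; lra.
  have wE : w < inf E by rewrite ws; rewrite /s in r0'; lra.
  by have := low w w0 wE _ Yy'; rewrite -cw ltNge h.
have := mdistD q p r; rewrite /s; lra.
Qed.

Lemma pass_near C Y L c p p' : contracting_set C Y -> geodesic L c ->
  nearest Y (c 0) p -> nearest Y (c L) p' -> C < mdist p p' ->
  exists2 u, 0 <= u <= L & mdist (c u) p <= 8 * C.
Proof.
move=> cs gc np np' far; have [C1 pY cY] := cs.
have L0 : 0 <= L by case: gc.
have [[t [y [t0 Yy ty]]]|h] := contracts_dicho gc cY.
  exact: (enter_near cs gc np t0 Yy ty).
have : mdist p p' <= C by apply: (h 0 L) => //; lra.
lra.
Qed.

Lemma far_nearest C Y x x' p p' : contracting_set C Y -> nearest Y x p ->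
  nearest Y x' p' -> C < mdist p p' ->
  mdist x p + mdist p x' <= mdist x x' + 16 * C.
Proof.
move=> cs np np' far.
have [c [gc c0 cL]] := geodesic_between x x'.
have [|||u u0 cu] := @pass_near C Y _ c p p' cs gc; rewrite ?c0 ?cL//.
rewrite (mdist_split gc c0 cL u0).
have := mdistD (c u) x p; have := mdistD (c u) p x'.
by rewrite (metric_sym p (c u)); lra.
Qed.

Lemma nearest_detour C Y x p y : contracting_set C Y -> nearest Y x p -> Y y ->
  mdist x p + mdist p y <= mdist x y + 16 * C.
Proof.
move=> cs np Yy; have [C1 _ _] := cs; have [le|far] := leP (mdist p y) C.
  by have := np.2 _ Yy; lra.
by apply: (far_nearest cs np _ far); split=> // y'; rewrite mdistxx mdist_ge0.
Qed.

Lemma far_nearest2 C Y x x' p p' : contracting_set C Y -> nearest Y x p ->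
  nearest Y x' p' -> C < mdist p p' ->
  mdist x p + mdist p p' + mdist p' x' <= mdist x x' + 32 * C.
Proof.
move=> cs np np' far; have := far_nearest cs np np' far.
have := nearest_detour cs np' np.1.
by rewrite (metric_sym x' p') (metric_sym p' p) (metric_sym x' p); lra.
Qed.

(** Far apart projections on [Z] force the geodesic from [z] to [y] to come near some [w] in [Z].
    Every point of this geodesic still has [y] as a nearest point of [Y], so [nearest_lip]
    applies. *)
Lemma behrstock C Y Z z y q r :
  contracting_set C Y -> contracting_set C Z -> nearest Y z y ->
  nearest Z z q -> nearest Z y r -> C < mdist q r ->
  exists2 w, Z w & forall y', nearest Y w y' -> mdist y y' <= 4 * C.
Proof.
move=> cY cZ ny nq nr far; have [C1 pY _] := cY; have [_ _ kZ] := cZ.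
have [c [gc c0 cL]] := geodesic_between z y.
have d0 := mdist_ge0 z y.
have [[t [w [t0 Zw tw]]]|h] := contracts_dicho gc kZ; last first.
  have : mdist q r <= C by apply: (h 0 (mdist z y)); rewrite ?c0 ?cL//; lra.
  lra.
exists w => // y' ny'.
have ny2 : nearest Y (c t) y.
  split; first exact: ny.1.
  move=> v Yv; have := ny.2 _ Yv; have := mdistD (c t) z v.
  by rewrite (mdist_split gc c0 cL t0); lra.
by have := nearest_lip cY ny2 ny'; lra.
Qed.

(** Add [nearest_detour] towards both end points: the length [L] cancels, and twice the distance to
    [p] is at most [32 * C]. *)
Lemma quasi_convex C Y L c t p : contracting_set C Y -> geodesic L c ->
  0 <= t <= L -> Y (c 0) -> Y (c L) -> nearest Y (c t) p ->
  mdist (c t) p <= 16 * C.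
Proof.
move=> cs gc t0 Y0 YL np.
have := nearest_detour cs np Y0; have := nearest_detour cs np YL.
have := mdistD p (c 0) (c L).
rewrite !(geodesicP gc)//; try lra.
rewrite subr0 sub0r normrN (distrC t).
rewrite !ger0_norm; try lra.
by rewrite (metric_sym (c 0) p); lra.
Qed.

End Contraction.

Lemma exists_nat_gt (R : realType) (r : R) : exists n : nat, r < n%:R.
Proof.
exists (Num.bound `|r|); apply: le_lt_trans (ler_norm r) _.
by apply: archi_boundP.
Qed.

(** The point [p] of [Y] projects near [z0] on [Z], hence far from [q]. The point of [Z] given by
    [behrstock] then projects on [Y] within [4 * C] of [p] and within [tau] of [y0]. *)
Lemma shadow_transfer (R : realType) (X : metricType R) (C tau : R)
    (Y Z : set X) y0 z0 z q p :
  geodesic_space X -> contracting_set C Y -> contracting_set C Z ->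
  (forall w p, Z w -> nearest Y w p -> mdist p y0 <= tau) ->
  (forall w p, Y w -> nearest Z w p -> mdist p z0 <= tau) ->
  nearest Z z q -> tau + C < mdist q z0 -> nearest Y z p ->
  mdist p y0 <= tau + 4 * C.
Proof.
move=> Xgeo cY cZ ZY YZ nq far np.
have [_ pY _] := cY; have [_ pZ _] := cZ; have [r nr] := pZ p.
have rz := YZ _ _ np.1 nr.
have [|w Zw h] := behrstock Xgeo cY cZ np nq nr.
  by have := mdistD r q z0; lra.
have [y' ny'] := pY w; have := h _ ny'; have := ZY _ _ Zw ny'.
by have := mdistD y' p y0; lra.
Qed.

(** * Chains of contracting sets *)

Section ShadowChain.
Context {R : realType} {X : metricType R}.
Hypothesis Xgeo : geodesic_space X.
Variables (C tau : R) (B : int -> set X) (e x : int -> X).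
Let sigma := tau + 4 * C.
Hypothesis tau_ge0 : 0 <= tau.
Hypothesis cB : forall n, contracting_set C (B n).
Hypothesis Be : forall n, B n (e n).
Hypothesis Bx : forall n, B n (x n).
Hypothesis shadow_next : forall n z p, B (n + 1) z -> nearest (B n) z p ->
  mdist p (x n) <= tau.
Hypothesis shadow_prev : forall n z p, B n z -> nearest (B (n + 1)) z p ->
  mdist p (e (n + 1)) <= tau.
(** The factor 20 exceeds the loss [4 * sigma + 32 * C] of [gap] by enough to gain one unit per set
    in [chain_progress]. *)
Hypothesis long : forall n, 20 * sigma <= mdist (e n) (x n).

Let C_ge1 : 1 <= C. Proof. by case: (cB 0). Qed.

(* The sets [B n] are crossed in order, each from [e n] to [x n]: [z] lies
   behind [B n] if it is seen at the entrance, ahead of [B n] if at the exit. *)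
Let behind z n := forall p, nearest (B n) z p -> mdist p (e n) <= sigma.
Let ahead z n := forall p, nearest (B n) z p -> mdist p (x n) <= sigma.

(** With [not_behind_and_ahead], this propagates [behind] forwards and [ahead] backwards along the
    chain. *)
Lemma behindVahead z n : behind z (n + 1) \/ ahead z n.
Proof.
have C1 := C_ge1.
have [bz|nb] := pselect (behind z (n + 1)); [by left|right].
have [q /not_implyP[nq /negP]] : exists q,
    ~ (nearest (B (n + 1)) z q -> mdist q (e (n + 1)) <= sigma).
  exact/existsNP.
rewrite -ltNge => far p np.
apply: (shadow_transfer Xgeo (cB n) (cB (n + 1)) _ _ nq _ np).
- exact: shadow_next.
- exact: shadow_prev.
- by move: far; rewrite /sigma; lra.
Qed.

Lemma not_behind_and_ahead z n : behind z n -> ahead z n -> False.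
Proof.
have C1 := C_ge1; have tau0 := tau_ge0.
move=> bz az; have [_ pB _] := cB n; have [p np] := pB z.
have := bz _ np; have := az _ np; have := long n.
have := mdistD p (e n) (x n); rewrite (metric_sym (e n) p) /sigma; lra.
Qed.

Lemma behindS z n : behind z n -> behind z (n + 1).
Proof.
by move=> bz; have [//|/(not_behind_and_ahead bz)] := behindVahead z n.
Qed.

Lemma aheadP z n : ahead z (n + 1) -> ahead z n.
Proof.
by move=> az; have [/not_behind_and_ahead/(_ az)|] := behindVahead z n.
Qed.

Lemma behind_le z (m n : int) : m <= n -> behind z m -> behind z n.
Proof.
move=> mn bz; have [k ->] : exists k : nat, n = m + k%:Z.
  by exists `|n - m|%N; lia.
elim: k => [|k IH]; first by rewrite addr0.
have -> : m + k.+1%:Z = m + k%:Z + 1 by lia.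
exact: behindS.
Qed.

Lemma ahead_le z (m n : int) : m <= n -> ahead z n -> ahead z m.
Proof.
move=> mn; have [k ->] : exists k : nat, n = m + k%:Z.
  by exists `|n - m|%N; lia.
elim: k => [|k IH]; first by rewrite addr0.
have -> : m + k.+1%:Z = m + k%:Z + 1 by lia.
by move=> /aheadP.
Qed.

Lemma behind_e m n : m <= n -> behind (e m) n.
Proof.
have C1 := C_ge1; have tau0 := tau_ge0.
move=> mn; apply: (behind_le mn) => p /(nearest_self (Be m)) ->.
by rewrite mdistxx /sigma; lra.
Qed.

Lemma ahead_e m n : n < m -> ahead (e m) n.
Proof.
have C1 := C_ge1.
move=> nm; apply: (@ahead_le _ _ (m - 1)); first lia.
move=> p np; rewrite /sigma; have : mdist p (x (m - 1)) <= tau.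
  by apply: shadow_next np; rewrite subrK.
lra.
Qed.

(** Apply [far_nearest2] to the projections of [z] and [z']; replacing them by [e n] and [x n] costs
    [sigma] four times. *)
Lemma gap z z' n : behind z n -> ahead z' n ->
  mdist z (e n) + mdist (e n) (x n) + mdist (x n) z'
    <= mdist z z' + 4 * sigma + 32 * C.
Proof.
have C1 := C_ge1; have tau0 := tau_ge0.
move=> bz az; have [_ pB _] := cB n.
have [p np] := pB z; have [p' np'] := pB z'.
have pe := bz _ np; have px := az _ np'.
have t1 := mdistD p (e n) (x n); have t2 := mdistD p' p (x n).
rewrite (metric_sym (e n) p) in t1.
have t3 := mdistD p z (e n); have t4 := mdistD p' (x n) z'.
rewrite (metric_sym (x n) p') in t4.
have far : C < mdist p p' by have := long n; rewrite /sigma in pe px *; lra.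
have := far_nearest2 Xgeo (cB n) np np' far; lra.
Qed.

Lemma chain_progress m (k : nat) : k%:R <= mdist (e m) (e (m + k%:Z)).
Proof.
have C1 := C_ge1; have tau0 := tau_ge0.
elim: k => [|k IH]; first by rewrite mdist_ge0.
have bz : behind (e m) (m + k%:Z) by apply: behind_e; lia.
have az : ahead (e (m + k.+1%:Z)) (m + k%:Z) by apply: ahead_e; lia.
have := gap bz az; have := long (m + k%:Z).
have := mdist_ge0 (x (m + k%:Z)) (e (m + k.+1%:Z)).
by rewrite -natr1 /sigma; lra.
Qed.

Lemma chain_progress_abs m n : `|m - n|%:~R <= mdist (e m) (e n).
Proof.
have [mn|nm] := leP m n.
  have -> : n = m + `|n - m|%N%:Z by lia.
  have -> : `|m - (m + `|n - m|%N%:Z)| = `|n - m|%N%:Z by lia.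
  exact: chain_progress.
rewrite metric_sym; have -> : m = n + `|m - n|%N%:Z by lia.
have -> : `|n + `|m - n|%N%:Z - n| = `|m - n|%N%:Z by lia.
exact: chain_progress.
Qed.

(** In the application [e] is the orbit of [o] and [b] that of an arbitrary base point. *)
Variables (b : int -> X) (delta delta' ell : R).
Hypothesis be : forall n, mdist (b n) (e n) <= delta.
Hypothesis bS : forall n, mdist (b n) (b (n + 1)) <= delta'.
Hypothesis ex : forall n, mdist (e n) (x n) <= ell.

Let delta_ge0 : 0 <= delta. Proof. exact: le_trans (mdist_ge0 _ _) (be 0). Qed.
Let delta'_ge0 : 0 <= delta'.
Proof. exact: le_trans (mdist_ge0 _ _) (bS 0). Qed.

Lemma chain_lipschitz m n : mdist (b m) (b n) <= delta' * `|m - n|%:~R.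
Proof.
have up (k : nat) i : mdist (b i) (b (i + k%:Z)) <= delta' * k%:R.
  elim: k => [|k IH]; first by rewrite addr0 mdistxx mulr0.
  have := bS (i + k%:Z); have := mdistD (b (i + k%:Z)) (b i) (b (i + k.+1%:Z)).
  have -> : i + k%:Z + 1 = i + k.+1%:Z by lia.
  by rewrite -natr1 mulrDr mulr1; lra.
have [mn|nm] := leP m n.
  have -> : n = m + `|n - m|%N%:Z by lia.
  have -> : `|m - (m + `|n - m|%N%:Z)| = `|n - m|%N%:Z by lia.
  exact: up.
rewrite metric_sym; have -> : m = n + `|m - n|%N%:Z by lia.
have -> : `|n + `|m - n|%N%:Z - n| = `|m - n|%N%:Z by lia.
exact: up.
Qed.

Lemma chain_qi : qi_embedding_int b.
Proof.
have d0 := delta_ge0; have d1 := delta'_ge0.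
exists (1 + delta'), (2 * delta); split; [lra|lra|] => m n.
have le1 : (1 + delta')^-1 <= 1 by rewrite invf_le1; lra.
have := chain_progress_abs m n; have := chain_lipschitz m n.
have : 0 <= `|m - n|%:~R :> R by rewrite ler0z.
move: (`|m - n|%:~R) => k k0; have := ler_wpM2r k0 le1; rewrite mul1r.
have := mdistD (e m) (b m) (b n); have := mdistD (e n) (e m) (b n).
have := mdistD (b m) (e m) (e n); have := mdistD (b n) (b m) (e n).
have := be m; have := be n.
rewrite (metric_sym (e m) (b m)) (metric_sym (e n) (b n)).
by rewrite mulrDl mul1r => *; apply/andP; split; lra.
Qed.

(** Otherwise [z] is ahead of [B (n - 1)]. By [gap] the way from [e m] to [z] leads through that
    set, far from [e m] by [chain_progress], so [b (n - 1)] would be closer to [z] than [b m]. *)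
Lemma chain_behind (k : nat) z (m n : int) : delta + (delta + ell) + 1 < k%:R ->
  nearest (range b) z (b m) -> m + k%:Z <= n -> behind z n.
Proof.
have C1 := C_ge1; have tau0 := tau_ge0; have d0 := delta_ge0.
move=> kbig nz mn.
have k1 : (1 < k)%N.
  rewrite -(ltr_nat R); have := mdist_ge0 (e 0) (x 0).
  by have := ex 0; lra.
have [|az] := behindVahead z (n - 1); first by rewrite subrK.
have bz : behind (e m) (n - 1) by apply: behind_e; lia.
have := gap bz az; have := long (n - 1).
have := chain_progress m (absz (n - 1 - m)%R).
have -> : m + (absz (n - 1 - m)%R)%:Z = n - 1 by lia.
have : k.-1%:R <= (absz (n - 1 - m)%R)%:R :> R by rewrite ler_nat; lia.
rewrite -subn1 natrB; last lia.
have := nz.2 (b (n - 1)) (imageT _ _).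
have := mdistD (x (n - 1)) z (b (n - 1)).
have := mdistD (e (n - 1)) (x (n - 1)) (b (n - 1)).
rewrite (metric_sym z (x (n - 1))) (metric_sym (x (n - 1)) (e (n - 1))).
have := ex (n - 1); have := be (n - 1); have := be m.
have := mdistD (b m) (e m) z; rewrite (metric_sym (e m) (b m)).
rewrite (metric_sym (b m) z) (metric_sym (e (n - 1)) (b (n - 1))).
rewrite /sigma; lra.
Qed.

Lemma chain_ahead (k : nat) z (m n : int) :
  2 * delta + 4 * sigma + 32 * C + 1 < k%:R ->
  nearest (range b) z (b m) -> n + k%:Z <= m -> ahead z n.
Proof.
have C1 := C_ge1; have tau0 := tau_ge0; have d0 := delta_ge0.
move=> kbig nz nm.
have k1 : (1 < k)%N by rewrite -(ltr_nat R); rewrite /sigma in kbig; lra.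
have [bz|//] := behindVahead z n.
have az : ahead (e m) (n + 1) by apply: ahead_e; lia.
have := gap bz az.
have := chain_progress (n + 1) (absz (m - (n + 1))%R).
have -> : n + 1 + (absz (m - (n + 1))%R)%:Z = m by lia.
have : k.-1%:R <= (absz (m - (n + 1))%R)%:R :> R by rewrite ler_nat; lia.
rewrite -subn1 natrB; last lia.
have := mdistD (x (n + 1)) (e (n + 1)) (e m).
have := nz.2 (b (n + 1)) (imageT _ _).
have := mdistD (e (n + 1)) z (b (n + 1)).
have := be (n + 1); have := be m.
have := mdistD (b m) z (e m).
rewrite (metric_sym (e (n + 1)) (b (n + 1))).
move: kbig; rewrite /sigma; lra.
Qed.

(* A geodesic whose end points have nearest points far apart in [range b]
   has to cross some [B n] from [e n] to [x n], hence comes close to [b n]. *)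
Lemma chain_contracts : exists D, contracts D (range b).
Proof.
have C1 := C_ge1; have tau0 := tau_ge0.
have [k k1] := exists_nat_gt (delta + (delta + ell) + 1).
have [k' k2] := exists_nat_gt (2 * delta + 4 * sigma + 32 * C + 1).
have [K [K1 K2]] : exists K : nat, delta + (delta + ell) + 1 < K%:R /\
    2 * delta + 4 * sigma + 32 * C + 1 < K%:R.
  exists (maxn k k'); split; [apply: lt_le_trans k1 _|apply: lt_le_trans k2 _];
    by rewrite ler_nat ?leq_maxl ?leq_maxr.
(* A geodesic crossing [B n] comes within the first term of [b n]; the second bounds distances
   between points whose indices differ by at most twice [K]. *)
pose D := Num.max (8 * C + sigma + delta) (delta' * K.*2%:R).
exists D => L c gc far s t p q.
suff W s' t' m n : m <= n -> 0 <= s' <= L -> 0 <= t' <= L ->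
    nearest (range b) (c s') (b m) -> nearest (range b) (c t') (b n) ->
    n - m <= K.*2%:Z.
  move=> s0 t0 np nq.
  have [m _ mp] := np.1; have [n _ nq'] := nq.1; subst p q.
  have h : `|m - n| <= K.*2%:Z.
    have [mn|nm] := leP m n.
      by rewrite distrC ger0_norm ?subr_ge0//; exact: (W s t).
    by rewrite ger0_norm ?(subr_ge0, ltW nm)//; exact: (W t s n m (ltW nm)).
  rewrite /D le_max; apply/orP; right.
  apply: le_trans (chain_lipschitz _ _) _; apply: ler_wpM2l => //.
  by rewrite -[K.*2%:R]/(K.*2%:Z%:~R) ler_int.
move: s' t' => {}s {}t mn s0 t0 nm nn; rewrite leNgt; apply/negP => big.
have bz : behind (c s) (m + K%:Z) by exact: (chain_behind K1 nm (lexx _)).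
have az : ahead (c t) (m + K%:Z).
  by apply: (chain_ahead K2 nn); move: big; clear; lia.
have [_ pB _] := cB (m + K%:Z).
have [u nu] := pB (c s); have [v nv] := pB (c t).
have [c' [gc' c0 cL im]] := subgeodesic gc s0 t0.
rewrite -c0 in nu bz; rewrite -cL in nv az.
have [|r r0 cr] := pass_near Xgeo (cB (m + K%:Z)) gc' nu nv.
  have := bz _ nu; have := az _ nv; have := long (m + K%:Z).
  have := mdistD u (e (m + K%:Z)) (x (m + K%:Z)).
  have := mdistD v u (x (m + K%:Z)).
  rewrite (metric_sym (e (m + K%:Z)) u) /sigma; lra.
have [w w0 cw] := im _ r0.
have := far w (b (m + K%:Z)) w0 (imageT _ _).
rewrite -cw ltNge => /negP; apply.
rewrite /D le_max; apply/orP; left.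
have := mdistD u (c' r) (b (m + K%:Z)).
have := mdistD (e (m + K%:Z)) u (b (m + K%:Z)).
have := bz _ nu; have := be (m + K%:Z).
rewrite (metric_sym (e _) (b _)); lra.
Qed.

End ShadowChain.

(** * Contracting quasi-lines *)

Section QuasiLines.
Context {R : realType} {X : metricType R}.
Implicit Types (x y z p q : X) (Y Z : set X) (C L K : R) (f : int -> X).

Lemma qi_proper f r : qi_embedding_int f ->
  exists N : nat, forall m n, mdist (f m) (f n) <= r -> `|m - n| <= N%:Z.
Proof.
move=> [lam [c [lam1 c0 qf]]]; have [N rN] := exists_nat_gt (lam * (r + c)).
exists N => m n dr; have /andP[lo _] := qf m n.
rewrite -(ler_int R); apply/ltW/(le_lt_trans _ rN).
by rewrite -ler_pdivrMl; lra.
Qed.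

Lemma qi_lipschitz f (N : nat) : qi_embedding_int f ->
  exists D, forall m n, `|m - n| <= N%:Z -> mdist (f m) (f n) <= D.
Proof.
move=> [lam [c [lam1 c0 qf]]]; exists (lam * N%:R + c) => m n mn.
have /andP[_ up] := qf m n; apply: (le_trans up).
rewrite lerD2r ler_wpM2l//; first lra.
by rewrite -[N%:R]/(N%:Z%:~R) ler_int.
Qed.

(** Points at least as close to [x] as [f 0] lie within [2 * mdist x (f 0)] of [f 0], so only
    finitely many indices compete. *)
Lemma qi_proximinal f : qi_embedding_int f -> proximinal (range f).
Proof.
move=> qf x; have [N hN] := qi_proper (2 * mdist x (f 0)) qf.
pose F (i : 'I_(N.*2.+1)) := mdist x (f (i%:Z - N%:Z)).
have lt0 : (N < N.*2.+1)%N by lia.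
case: (@arg_minP _ _ _ (Ordinal lt0) xpredT F isT) => i _ imin.
exists (f (i%:Z - N%:Z)); split; first exact: imageT.
move=> _ [n _ <-].
have [le|gt] := leP (mdist x (f n)) (mdist x (f 0)); last first.
  apply: le_trans (ltW gt); apply: le_trans (imin (Ordinal lt0) isT) _.
  by rewrite /F /= subrr.
have nN : `|0 - n| <= N%:Z.
  apply: hN; have := mdistD x (f 0) (f n); rewrite (metric_sym (f 0) x); lra.
have lt1 : (absz (n + N%:Z)%R < N.*2.+1)%N by lia.
apply: le_trans (imin (Ordinal lt1) isT) _; rewrite /F /=.
by have -> : (absz (n + N%:Z)%R)%:Z - N%:Z = n by lia.
Qed.

(** Equivalently, twice the Gromov product of [f l] and [f n] at [f m] is at most [K]. *)
Definition taut K f := forall l m n, l <= m -> m <= n ->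
  mdist (f l) (f m) + mdist (f m) (f n) <= mdist (f l) (f n) + K.

Hypothesis Xgeo : geodesic_space X.

(* The nearest points on the orbit to consecutive integer points of a geodesic
   have indices at bounded distance from each other, so these indices cannot
   jump over [m]. *)
Lemma qi_taut C f : qi_embedding_int f -> contracting_set C (range f) ->
  exists K, taut K f.
Proof.
move=> qf cf; have [C1 pf _] := cf.
(* Twice [16 * C] from [quasi_convex], plus a step of length at most 1. *)
have [N hN] := qi_proper (32 * C + 1) qf.
have [D hD] := qi_lipschitz N qf.
exists (2 * (16 * C + D)) => l m n lm mn.
have [c [gc c0 cL]] := geodesic_between Xgeo (f l) (f n).
set L := mdist (f l) (f n) in gc cL *.
have L0 : 0 <= L by exact: mdist_ge0.
suff [t [t0 h]] : exists t, 0 <= t <= L /\ mdist (c t) (f m) <= 16 * C + D.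
  have := mdist_split gc c0 cL t0; rewrite -/L.
  have := mdistD (c t) (f l) (f m); have := mdistD (c t) (f m) (f n).
  by rewrite (metric_sym (f m) (c t)); lra.
apply: contrapT => none.
have close t k : 0 <= t <= L -> mdist (c t) (f k) <= 16 * C ->
    ~ `|k - m| <= N%:Z.
  move=> t0 tk /hD km; apply: none; exists t; split => //.
  by have := mdistD (f k) (c t) (f m); lra.
(* Induction on integer times cut off at [L]: indices jump by at most [N], and [close] excludes
   those within [N] of [m]. *)
have stay (i : nat) k : mdist (c (Num.min i%:R L)) (f k) <= 16 * C -> k < m.
  have ti (j : nat) : 0 <= Num.min (j%:R : R) L <= L.
    by rewrite le_min ler0n L0 ge_min lexx orbT.
  elim: i k => [|i IH] k ck.
    have /hN kl : mdist (f k) (f l) <= 32 * C + 1.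
      by move: ck; rewrite min_l// c0 (metric_sym (f k)); lra.
    by have := close _ _ (ti 0%N) ck; move: kl lm; clear; lia.
  have [_ [[j _ <-] jmin]] := pf (c (Num.min i%:R L)).
  have nj : nearest (range f) (c (Num.min i%:R L)) (f j).
    by split; first exact: imageT.
  have cj : mdist (c (Num.min i%:R L)) (f j) <= 16 * C.
    apply: (quasi_convex Xgeo cf gc (ti i)) nj.
      by rewrite c0; exact: imageT.
    by rewrite cL; exact: imageT.
  have jm := IH _ cj.
  have : mdist (c (Num.min i%:R L)) (c (Num.min i.+1%:R L)) <= 1.
    rewrite (geodesicP gc)// -natr1 distrC.
    by rewrite /Num.min; do 2 case: ifP => ?; rewrite ger0_norm; lra.
  move=> step.
  have /hN jk : mdist (f j) (f k) <= 32 * C + 1.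
    have := mdistD (c (Num.min i%:R L)) (f j) (f k).
    have := mdistD (c (Num.min i.+1%:R L)) (c (Num.min i%:R L)) (f k).
    by rewrite (metric_sym (f j) (c _)); lra.
  by have := close _ _ (ti i.+1) ck; move: jk jm; clear; lia.
have [i Li] := exists_nat_gt L.
have := stay i n; rewrite min_r; last exact: ltW.
rewrite cL mdistxx => nm.
by move: (nm (ltac:(lra))); rewrite ltNge mn.
Qed.

(* A quasi-line with two points that project near [o] turns back near [o], so
   it does not project far away in between. *)
Lemma taut_middle C K tau Y f o l m n p q r : contracting_set C Y -> taut K f ->
  l <= m -> m <= n -> nearest Y (f l) p -> nearest Y (f m) q ->
  nearest Y (f n) r -> mdist p o <= tau -> mdist r o <= tau ->
  mdist q o <= 5 * tau + 2 * K + 64 * C.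
Proof.
move=> cY tf lm mn np nq nr po ro; have [C1 _ _] := cY.
have tau0 : 0 <= tau := le_trans (mdist_ge0 _ _) po.
have K0 : 0 <= K.
  by have := tf l l l (lexx _) (lexx _); rewrite mdistxx; lra.
have [pq|pq] := leP (mdist q p) C; first by have := mdistD p q o; lra.
have [rq|rq] := leP (mdist q r) C; first by have := mdistD r q o; lra.
rewrite metric_sym in pq; rewrite metric_sym in rq.
have := far_nearest Xgeo cY np nq pq; have := far_nearest Xgeo cY nr nq rq.
have := tf _ _ _ lm mn; have := nq.2 _ np.1.
have := mdistD p (f l) (f n); have := mdistD o p (f n).
have := mdistD r o (f n).
have := mdistD (f m) q p; have := mdistD p q o; have := mdist_ge0 r (f m).
rewrite (metric_sym q (f m)) (metric_sym (f m) p) (metric_sym (f n) r).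
by rewrite (metric_sym (f n) (f m)) (metric_sym o r); lra.
Qed.

Lemma no_three_far C K tau (I : eqType) (A : I -> set X) (o : I -> X) f
    (i j k : I) l m n p q r :
  (forall i, contracting_set C (A i)) -> taut K f -> 0 <= tau ->
  (forall i j z p q, i != j -> nearest (A i) z p -> nearest (A j) z q ->
    mdist p (o i) <= tau \/ mdist q (o j) <= tau) ->
  i != j -> j != k -> i != k ->
  nearest (A i) (f l) p -> nearest (A j) (f m) q -> nearest (A k) (f n) r ->
  [\/ mdist p (o i) <= 5 * tau + 2 * K + 64 * C,
      mdist q (o j) <= 5 * tau + 2 * K + 64 * C |
      mdist r (o k) <= 5 * tau + 2 * K + 64 * C].
Proof.
move=> cA tf tau0 alt.
set T := 5 * tau + 2 * K + 64 * C.
have K0 : 0 <= K by have := tf 0 0 0 (lexx _) (lexx _); rewrite mdistxx; lra.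
have tauT : tau <= T by have [C1 _ _] := cA i; rewrite /T; lra.
suff main i' j' k' l' m' n' p' q' r' : i' != j' -> j' != k' ->
    l' <= m' -> m' <= n' ->
    nearest (A i') (f l') p' -> nearest (A j') (f m') q' ->
    nearest (A k') (f n') r' -> [\/ mdist p' (o i') <= T,
      mdist q' (o j') <= T | mdist r' (o k') <= T].
  move=> ij jk ik np nq nr.
  have ji : j != i by rewrite eq_sym.
  have kj : k != j by rewrite eq_sym.
  have ki : k != i by rewrite eq_sym.
  have [lm|/ltW ml] := leP l m; have [mn|/ltW nm] := leP m n;
      have [ln|/ltW nl] := leP l n.
  - exact: (main i j k l m n).
  - exact: (main i j k l m n).
  - by case: (main i k j l n m p r q) => //;
      [constructor 1|constructor 3|constructor 2].
  - by case: (main k i j n l m r p q) => //;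
      [constructor 3|constructor 1|constructor 2].
  - by case: (main j i k m l n q p r) => //;
      [constructor 2|constructor 1|constructor 3].
  - by case: (main j k i m n l q r p) => //;
      [constructor 2|constructor 3|constructor 1].
  - by case: (main k j i n m l r q p) => //;
      [constructor 3|constructor 2|constructor 1].
  - by case: (main k j i n m l r q p) => //;
      [constructor 3|constructor 2|constructor 1].
move=> ij jk lm mn np nq nr.
have [?|pT] := leP (mdist p' (o i')) T; first by constructor 1.
have [?|rT] := leP (mdist r' (o k')) T; first by constructor 3.
constructor 2.
have [_ pj _] := cA j'.
have [p1 np1] := pj (f l'); have [r1 nr1] := pj (f n').
apply: (taut_middle (cA j') tf lm mn np1 nq nr1).
  have [|//] := alt _ _ _ _ _ ij np np1; lra.
rewrite eq_sym in jk; have [|//] := alt _ _ _ _ _ jk nr nr1; lra.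
Qed.

(** The way from [x] to [x'] follows [Y] from near [e] to near [e'], so it passes by [e]. *)
Lemma separated_shadows C tau Y e e' x x' p p' : contracting_set C Y ->
  nearest Y x p -> nearest Y x' p' -> mdist p e <= tau -> mdist p' e' <= tau ->
  2 * tau + C < mdist e e' -> mdist x e <= mdist x x' + 32 * C + tau.
Proof.
move=> cY np np' pe pe' far.
have := mdistD p e e'; have := mdistD p' p e'; have := mdistD p x e.
rewrite (metric_sym e p) => h1 h2 h3.
have d : C < mdist p p' by lra.
have := far_nearest2 Xgeo cY np np' d.
by have := mdist_ge0 p p'; have := mdist_ge0 p' x'; lra.
Qed.

End QuasiLines.

(* The unqualified name is shadowed by a lemma of [fingraph]. *)
Local Notation axis := Defs.cycle_orbit.

(** * Link with the definitions by diameters and closed neighborhoods *)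

Section Translation.
Context {R : realType} {X : metricType R}.
Implicit Types (x y z p q : X) (Y Z : set X) (C r : R).

Lemma le_diamP (A : set X) r : 0 <= r ->
  (diam A <= r%:E)%E <-> forall x y, A x -> A y -> mdist x y <= r.
Proof.
move=> r0; split => [dA x y Ax Ay|dA].
  rewrite -lee_fin; apply: le_trans dA; apply: ereal_sup_ubound; right.
  by exists (x, y).
apply: ge_ereal_sup => _ [->|[[x y] [Ax Ay] <-]]; first by rewrite lee_fin.
by rewrite lee_fin; exact: dA.
Qed.

Lemma edist_inf_le Y x y : Y y -> (edist_inf Y x <= (mdist x y)%:E)%E.
Proof.
by move=> Yy; apply: ereal_inf_lbound; exists y => //; exact: edist_mdist.
Qed.

Lemma closed_nbhdW r Y x y : Y y -> mdist x y <= r -> closed_nbhd r Y x.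
Proof.
by move=> Yy xy; apply: le_trans (edist_inf_le _ Yy) _; rewrite lee_fin.
Qed.

(** The infimum need not be attained, hence the slack 1. *)
Lemma closed_nbhd_ex r Y x : closed_nbhd r Y x ->
  exists2 y, Y y & mdist x y <= r + 1.
Proof.
move=> xY; have /ereal_inf_lt [_ [y Yy <-]] : (edist_inf Y x < (r + 1)%:E)%E.
  by apply: le_lt_trans xY _; rewrite lte_fin ltrDl.
by rewrite edist_mdist lte_fin => /ltW; exists y.
Qed.

Lemma nearest_edist_inf Y x y : nearest Y x y -> edist_inf Y x = (mdist x y)%:E.
Proof.
move=> [Yy ymin]; apply/eqP; rewrite eq_le edist_inf_le//=.
apply: le_ereal_inf_tmp => _ [z Yz <-].
by rewrite edist_mdist lee_fin; exact: ymin.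
Qed.

Lemma proj_ptP Y x y : proj_pt Y x y <-> nearest Y x y.
Proof.
split=> [[Yy xy]|ny]; last first.
  by split; [exact: ny.1|rewrite (nearest_edist_inf ny)].
by split=> // z Yz; rewrite -lee_fin xy; exact: edist_inf_le.
Qed.

Lemma proximinal_closed Y : proximinal Y -> closed Y.
Proof.
move=> pY x clx; have [y [Yy ymin]] := pY x.
suff -> : x = y by [].
apply: mdist_positivity; apply/eqP; rewrite eq_le mdist_ge0 andbT leNgt.
apply/negP => xy; have [z [Yz]] := clx _ (nbhsx_ballx x _ xy).
by rewrite ballEmdist /= ltNge ymin.
Qed.

Lemma contractingP Y : proximinal Y ->
  contracting Y <-> exists C, contracts C Y.
Proof.
move=> pY; split=> [[C [_ C0 cY]]|[D cY]].
  exists C => L c gc far s t p q s0 t0 np nq.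
  have seg : geodesic_segment (c @` `[0, L]) by exists L, c.
  have avoid : c @` `[0, L] `&` closed_nbhd C Y = set0.
    rewrite -subset0 => _ [[u + <-]]; rewrite /= in_itv /= => u0.
    have [y ny] := pY (c u).
    rewrite /closed_nbhd /= (nearest_edist_inf ny) lee_fin leNgt far//.
    by case: ny.
  apply: ((le_diamP _ C0).1 (cY _ seg avoid)).
  - by exists (c s); [exists s => //; rewrite /= in_itv|apply/proj_ptP].
  - by exists (c t); [exists t => //; rewrite /= in_itv|apply/proj_ptP].
have m0 : 0 <= Num.max D 0 by rewrite le_max lexx orbT.
exists (Num.max D 0); split=> //; first exact: proximinal_closed.
move=> _ [L [c [gc ->]]] far; apply/le_diamP => // p q.
move=> [_ [s + <-] /proj_ptP np] [_ [t + <-] /proj_ptP nq].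
rewrite /= !in_itv /= => s0 t0.
apply: (contractsW _ cY gc _ s0 t0 np nq); first by rewrite le_max lexx.
move=> u y u0 Yy; rewrite ltNge; apply/negP => uy.
suff : set0 (c u) by [].
rewrite -far; split; last exact: closed_nbhdW Yy uy.
by exists u => //; rewrite /= in_itv.
Qed.

End Translation.

(** * Integer powers in a group *)

Section ZPowers.
Context {G : groupType}.
Implicit Types (g u : G) (m n : int).
Local Open Scope group_scope.

Lemma zexpgS g n : zexpg g (n + 1)%R = zexpg g n * g.
Proof.
case: n => [k|[|k]].
- have -> : (Posz k + 1)%R = Posz k.+1 by lia.
  exact: expgSr.
- by rewrite /= expg1 mulVg.
- have -> : (Negz k.+1 + 1)%R = Negz k by lia.
  by rewrite /= (expgS g k.+1) invgM mulgVK.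
Qed.

Lemma zexpgDn g m (k : nat) : zexpg g (m + k%:Z)%R = zexpg g m * g ^+ k.
Proof.
elim: k => [|k IH]; first by rewrite addr0 expg0 mulg1.
have -> : (m + k.+1%:Z = m + k%:Z + 1)%R by lia.
by rewrite zexpgS IH expgSr mulgA.
Qed.

Lemma zexpgD g m n : zexpg g (m + n)%R = zexpg g m * zexpg g n.
Proof.
case: n => k; first exact: zexpgDn.
apply: (@mulIg _ (g ^+ k.+1)); rewrite -zexpgDn /= mulgVK.
by congr zexpg; lia.
Qed.

Lemma zexpgN g n : zexpg g (- n)%R = (zexpg g n)^-1.
Proof. by apply: (@mulIg _ (zexpg g n)); rewrite -zexpgD addNr mulVg. Qed.

Lemma zexpg_conj g u n : zexpg (u * g * u^-1) n = u * zexpg g n * u^-1.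
Proof.
have conjX (k : nat) : (u * g * u^-1) ^+ k = u * g ^+ k * u^-1.
  elim: k => [|k IH]; first by rewrite !expg0 mulg1 mulgV.
  by rewrite !expgSr IH !mulgA mulgVK.
by case: n => k /=; rewrite conjX// !invgM invgK mulgA.
Qed.

End ZPowers.

(** * Contracting elements *)

Section Isometries.
Context {R : realType} {G : groupType} {X : metricType R}.
Variable act : G -> X -> X.
Hypothesis act_iso : isometric_action act.
Implicit Types (g h s u v w : G) (x y z p q o : X) (Y : set X) (C r : R).

Lemma act1 x : act 1%g x = x. Proof. by case: act_iso. Qed.

Lemma actM u v x : act (u * v)%g x = act u (act v x).
Proof. by case: act_iso. Qed.

Lemma actK u x : act u^-1%g (act u x) = x.
Proof. by rewrite -actM mulVg act1. Qed.

Lemma actVK u x : act u (act u^-1%g x) = x.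
Proof. by rewrite -actM mulgV act1. Qed.

Lemma mdist_act u x y : mdist (act u x) (act u y) = mdist x y.
Proof. by case: act_iso. Qed.

Lemma mdist_actV u x y : mdist (act u^-1%g x) y = mdist x (act u y).
Proof. by rewrite -(mdist_act u) actVK. Qed.

Definition translate u Y : set X := [set x | Y (act u^-1%g x)].

Lemma nearest_translate u Y x p : nearest (translate u Y) x p <->
  nearest Y (act u^-1%g x) (act u^-1%g p).
Proof.
split=> -[Yp pmin]; split=> // y Yy.
  rewrite mdist_act mdist_actV; apply: pmin.
  by rewrite /translate /= actK.
by have := pmin _ Yy; rewrite !mdist_act.
Qed.

Lemma contracting_set_translate u C Y :
  contracting_set C Y -> contracting_set C (translate u Y).
Proof.
move=> [C1 pY cY]; split=> // [x|L c gc far s t p q s0 t0].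
  have [y ny] := pY (act u^-1%g x); exists (act u y).
  by apply/nearest_translate; rewrite actK.
move=> /nearest_translate np /nearest_translate nq.
rewrite -(mdist_act u^-1%g).
apply: (cY L (fun r => act u^-1%g (c r)) _ _ s t _ _ s0 t0 np nq).
  by split=> [|a b a0 b0]; [case: gc|rewrite mdist_act; case: gc => _; apply].
move=> r y r0 Yy; rewrite mdist_actV; apply: far => //.
by rewrite /translate /= actK.
Qed.

Lemma orbitS o h n k : axis act o h (act (zexpg h k) (act (zexpg h n) o)).
Proof. by exists (k + n)%R => //; rewrite zexpgD actM. Qed.

Lemma nearest_orbit o h k x p : nearest (axis act o h) x p ->
  nearest (axis act o h) (act (zexpg h k) x) (act (zexpg h k) p).
Proof.
move=> [[n _ <-] pmin]; split; first exact: orbitS.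
move=> _ [m _ <-]; have := pmin _ (orbitS o h m (- k)).
by rewrite mdist_act zexpgN [leRHS]metric_sym mdist_actV [leRHS]metric_sym.
Qed.

Lemma contracting_elementP o h :
  qi_embedding_int (fun n => act (zexpg h n) o) ->
  contracting_element act o h <-> exists C, contracting_set C (axis act o h).
Proof.
move=> qh; have pY := qi_proximinal qh.
split=> [[/(contractingP pY)[C cY] _]|[C [_ _ cY]]].
  exists (Num.max 1 C); split=> //; first by rewrite le_max lexx.
  by apply: contractsW cY; rewrite le_max lexx orbT.
by split=> //; apply/contractingP => //; exists C.
Qed.

Hypothesis Xgeo : geodesic_space X.

Definition casts_near o h s r w := forall n p,
  nearest (axis act o h) (act w (act (zexpg s n) o)) p -> mdist p o <= r.

(** The translates of the axis of [h] by the powers of [f] form a chain as above. All base points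
    [o'] are covered because [contracting_conj] moves the base point. *)
Lemma chain_contracting o h w C tau (N : nat) :
  contracting_set C (axis act o h) -> 0 <= tau ->
  casts_near o h h tau w -> casts_near o h h tau w^-1%g ->
  20 * (tau + 4 * C) <= mdist o (act (h ^+ N)%g o) ->
  forall o', contracting_element act o' (h ^+ N * w)%g.
Proof.
move=> ch tau0 near1 near2 long o'.
set f := (h ^+ N * w)%g; set O := axis act o h in ch *.
pose B n := translate (zexpg f n) O.
pose e n := act (zexpg f n) o.
pose x n := act (zexpg f n) (act (h ^+ N)%g o).
have O0 : O o by exists 0 => //=; exact: act1.
have Be n : B n (e n) by rewrite /B /e /translate /= actK.
have ON : O (act (h ^+ N)%g o) by exists N%:Z.
have Bx n : B n (x n) by rewrite /B /x /translate /= actK.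
have cB n : contracting_set C (B n) by exact: contracting_set_translate.
have fS n z :
    act (zexpg f (n + 1))^-1%g z = act f^-1%g (act (zexpg f n)^-1%g z).
  by rewrite zexpgS invgM actM.
(* Up to [zexpg f n], the next set is the axis moved by [h ^+ N * w], and moving by [w] alone makes
   it project near [o]. *)
have next n z p : B (n + 1) z -> nearest (B n) z p -> mdist p (x n) <= tau.
  rewrite /B /translate /= fS => -[i _ zi] /nearest_translate np.
  have := nearest_orbit (- N%:Z) np; rewrite zexpgN /= -!actM.
  rewrite /x -!mdist_actV; move: np zi => _ zi.
  have -> : act ((h ^+ N)^-1 * (zexpg f n)^-1)%g z = act w (act (zexpg h i) o).
    by rewrite zi !actM {3}/f invgM actM actVK.
  by rewrite actM; exact: near1.
(* Up to [zexpg f (n + 1)], the previous set is the axis moved by [w^-1], as [h ^- N] preserves the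
   axis. *)
have prev n z p : B n z -> nearest (B (n + 1)) z p ->
    mdist p (e (n + 1)) <= tau.
  rewrite /B {1}/translate /= => -[i _ zi] /nearest_translate.
  rewrite !fS -zi {1}/f invgM actM.
  rewrite -[act (h ^+ N)^-1%g _]actM -[(h ^+ N)^-1%g]/(zexpg h N%:Z)^-1%g.
  rewrite -zexpgN -zexpgD => /near2.
  by rewrite zexpgN -invgM -[(zexpg h N%:Z * w)%g]/f -fS mdist_actV.
have long' n : 20 * (tau + 4 * C) <= mdist (e n) (x n) by rewrite mdist_act.
pose b n := act (zexpg f n) o'.
have be n : mdist (b n) (e n) <= mdist o' o by rewrite mdist_act.
have bS n : mdist (b n) (b (n + 1)) <= mdist o' (act f o').
  by rewrite /b zexpgS actM mdist_act.
have ex n : mdist (e n) (x n) <= mdist o (act (h ^+ N)%g o).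
  by rewrite mdist_act.
have qb : qi_embedding_int b.
  exact: (chain_qi Xgeo tau0 cB Be next prev long' be bS).
split=> //; apply/contractingP; first exact: qi_proximinal qb.
exact: (chain_contracts Xgeo tau0 cB Be next prev long' be bS ex).
Qed.

Lemma contracting_conj o (c x : G) : contracting_element act (act c^-1%g o) x ->
  contracting_element act o (c * x * c^-1)%g.
Proof.
move=> cx; have qx := cx.2.
have orbE n : act (zexpg (c * x * c^-1)%g n) o
    = act c (act (zexpg x n) (act c^-1%g o)) by rewrite zexpg_conj !actM.
have qc : qi_embedding_int (fun n => act (zexpg (c * x * c^-1)%g n) o).
  have [lam [k [l1 k0 h]]] := qx; exists lam, k; split=> // m n.
  by rewrite !orbE mdist_act; exact: h.
have [C cC] := (contracting_elementP qx).1 cx.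
apply/(contracting_elementP qc); exists C.
suff -> : axis act o (c * x * c^-1)%g = translate c (axis act (act c^-1%g o) x).
  exact: contracting_set_translate.
apply/seteqP; split=> [_ [n _ <-]|z [n _ zn]].
  by exists n => //; rewrite orbE actK.
by exists n => //; rewrite orbE zn actVK.
Qed.

End Isometries.

(** * Small subsets of a group *)

Section Small.
Context {G : groupType}.
Implicit Types (A B : set G) (P Q : seq G) (a b g : G).

Definition hits A P a b := count (fun p => `[< A (a * p * b)%g >]) P.

Definition small A := forall k : nat, exists2 P, (0 < size P)%N &
  forall a b, (k * hits A P a b <= size P)%N.

Lemma small_sub A B : A `<=` B -> small B -> small A.
Proof.
move=> AB sB k; have [P P0 hP] := sB k; exists P => // a b.
apply: leq_trans (hP a b); rewrite leq_mul2l; apply/orP; right.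
by apply: sub_count => p /asboolP /AB ?; exact/asboolP.
Qed.

Lemma count_allpairs (S T U : Type) (P : pred U) (f : S -> T -> U) s t :
  count P (allpairs f s t) = (\sum_(x <- s) count (fun y => P (f x y)) t)%N.
Proof.
elim: s => [|x s IH]; first by rewrite big_nil.
by rewrite big_cons -IH /allpairs /= count_cat count_map.
Qed.

Lemma count_exchange (S T : Type) (P : S -> pred T) (s : seq S) (t : seq T) :
  (\sum_(x <- s) count (P x) t = \sum_(y <- t) count (P ^~ y) s)%N.
Proof.
under eq_bigr do rewrite -sum1_count big_mkcond.
rewrite exchange_big; apply: eq_bigr => y _.
by rewrite -[RHS]sum1_count [RHS]big_mkcond.
Qed.

Lemma sum_count_le (S T : Type) (P : S -> pred T) (s : seq S) (t : seq T)
    (k m : nat) : (forall x, (k * count (P x) t <= m)%N) ->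
  (k * \sum_(x <- s) count (P x) t <= size s * m)%N.
Proof.
move=> h; rewrite big_distrr /= -sum1_size big_distrl /=.
by apply: leq_sum => x _; rewrite mul1n.
Qed.

Lemma half_sum (k x y n : nat) :
  (k.*2 * x <= n -> k.*2 * y <= n -> k * (x + y) <= n)%N.
Proof. by rewrite -mul2n -!mulnA mulnDr; lia. Qed.

(** In a product [p * q], a fixed [q] is absorbed into [b] and a fixed [p] into [a]; each of the two
    bounds is used with [2 * k]. *)
Lemma smallU A B : small A -> small B -> small (A `|` B).
Proof.
move=> sA sB k; have [P P0 hP] := sA (k.*2); have [Q Q0 hQ] := sB (k.*2).
exists (allpairs *%g P Q); first by rewrite size_allpairs muln_gt0 P0.
move=> a b; rewrite /hits count_allpairs size_allpairs.
pose hA p q := `[< A (a * p * (q * b))%g >].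
pose hB p q := `[< B (a * p * q * b)%g >].
apply: (@leq_trans (k * (\sum_(p <- P) count (hA p) Q +
    \sum_(p <- P) count (hB p) Q))%N).
  rewrite leq_mul2l; apply/orP; right; rewrite -big_split /=.
  apply: leq_sum => p _; apply: (@leq_trans (count (predU (hA p) (hB p)) Q)).
    apply: sub_count => q /asboolP [] h; apply/orP; [left|right];
      by apply/asboolP; move: h; rewrite !mulgA.
  by rewrite -count_predUI leq_addr.
rewrite count_exchange.
have h1 := @sum_count_le _ _ (fun q p => hA p q) Q P k.*2 (size P)
  (fun q => hP a (q * b)%g).
have h2 := @sum_count_le _ _ hB P Q k.*2 (size Q) (fun p => hQ (a * p)%g b).
by apply: half_sum; [rewrite [leqRHS]mulnC; exact: h1|exact: h2].
Qed.

Lemma small0 : small set0.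
Proof.
move=> k; exists [:: 1%g] => // a b.
by rewrite /hits /= asboolF// muln0.
Qed.

Lemma small_bigU (I : eqType) (s : seq I) (A : I -> set G) :
  (forall i, i \in s -> small (A i)) ->
  small [set g | exists2 i, i \in s & A i g].
Proof.
elim: s => [|i s IH] sA.
  by apply: small_sub small0 => g [i]; rewrite in_nil.
apply: (@small_sub _ (A i `|` [set g | exists2 i, i \in s & A i g])).
  move=> g [j]; rewrite inE => /orP[/eqP->|js] Ajg; first by left.
  by right; exists j.
apply: smallU; first by apply: sA; rewrite mem_head.
by apply: IH => j js; apply: sA; rewrite inE js orbT.
Qed.

Lemma small_translate A u : small A -> small [set g | A (g * u)%g].
Proof.
move=> sA k; have [P P0 hP] := sA k; exists P => // a b.
apply: leq_trans (hP a (b * u)%g); rewrite leq_mul2l; apply/orP; right.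
by apply: sub_count => p /asboolP h; apply/asboolP; move: h; rewrite /= !mulgA.
Qed.

(** For [k = 2] and [b = 1], at most half of the list is bad. *)
Lemma small_escape A : small A ->
  exists2 P, (0 < size P)%N & forall a, exists2 p, p \in P & ~ A (a * p)%g.
Proof.
move=> sA; have [P P0 hP] := sA 2; exists P => // a.
apply: contrapT => none; have := hP a 1%g.
suff -> : hits A P a 1%g = size P by clear none hP; lia.
apply/eqP; rewrite -all_count; apply/allP => p pP; apply/asboolP.
by rewrite mulg1; apply: contrapT => nA; apply: none; exists p.
Qed.

(** In an [m] by [m] array, [E1] marks at most two entries per row and [E2] at most two per column,
    so at most [4 * m] entries are bad. *)
Lemma small_of_pairs A (F : nat -> nat -> G) :
  (forall a b, exists E1 E2 : nat -> nat -> bool,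
    [/\ forall i m, (count (E1 i) (iota 0 m) <= 2)%N,
        forall j m, (count (E2 ^~ j) (iota 0 m) <= 2)%N &
        forall i j, A (a * F i j * b)%g -> E1 i j || E2 i j]) ->
  small A.
Proof.
move=> h k; pose m := (4 * k).+1; pose s := iota 0 m.
have ss : size s = m by rewrite size_iota.
exists (allpairs F s s) => [|a b]; first by rewrite size_allpairs ss.
have [E1 [E2 [h1 h2 hA]]] := h a b.
rewrite /hits count_allpairs size_allpairs ss.
have e1 := @sum_count_le _ _ E1 s s 1 2 (fun i => ltac:(by rewrite mul1n h1)).
have e2 := @sum_count_le _ _ (fun j i => E2 i j) s s 1 2
  (fun j => ltac:(by rewrite mul1n h2)).
rewrite -count_exchange in e2.
apply: (@leq_trans (k * (\sum_(i <- s) count (E1 i) s +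
    \sum_(i <- s) count (E2 i) s))%N).
  rewrite leq_mul2l; apply/orP; right; rewrite -big_split /=.
  apply: leq_sum => i _; apply: (@leq_trans (count (predU (E1 i) (E2 i)) s)).
    by apply: sub_count => j /asboolP /hA.
  exact: leq_trans (leq_addr _ _) (eq_leq (count_predUI _ _ _)).
rewrite ss in e1 e2; move: e1 e2.
set x := (\sum_(_ <- s) count (E1 _) s)%N; set y := (\sum_(_ <- s) _)%N.
rewrite /m; clear; nia.
Qed.

Lemma count_le2 (T : eqType) (P : pred T) (s : seq T) : uniq s ->
  (forall x y z, x != y -> y != z -> x != z -> P x -> P y -> P z -> False) ->
  (count P s <= 2)%N.
Proof.
move=> us h; rewrite -size_filter.
have := seq.filter_uniq P us; have := seq.filter_all P s.
case: (seq.filter P s) => [//|x [//|y [//|z t]]] /= /and4P[Px Py Pz _].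
rewrite !inE !negb_or => /andP[/and3P[xy xz _] /andP[/andP[yz _] _]].
by case: (h x y z).
Qed.

End Small.

(** * Small exceptional sets for one action *)

Section OneSpace.
Context {R : realType} {G : groupType} {X : metricType R}.
Variables (act : G -> X -> X) (o : X).
Hypothesis act_iso : isometric_action act.
Hypothesis Xgeo : geodesic_space X.
Implicit Types (g h s u v w : G) (x y z p q : X) (Y : set X) (C r : R).

Let orb h n := act (zexpg h n) o.

Lemma axis_base h : axis act o h o.
Proof. by exists 0 => //=; exact: act1. Qed.

Lemma weakly_independent_sym g h :
  weakly_independent act o g h -> weakly_independent act o h g.
Proof.
by case=> rho rho0 gh; exists rho => // r r0; rewrite setIC; exact: gh.
Qed.

Lemma axis_contracting_set h : contracting_element act o h ->
  exists C, contracting_set C (axis act o h).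
Proof. by move=> ch; apply/(contracting_elementP ch.2). Qed.

(** If [p] is far from [o], the geodesic from [z] to [o] passes within [8 * C] of [p] and stays
    within [16 * C] of the axis of [h]. So [p] and [o] both lie in the [24 * C]-neighborhoods of the
    two axes. *)
Lemma independent_shadow g h : contracting_element act o g ->
  contracting_element act o h -> weakly_independent act o g h ->
  exists2 tau, 0 <= tau & forall z p, axis act o h z ->
    nearest (axis act o g) z p -> mdist p o <= tau.
Proof.
move=> /axis_contracting_set[C1 c1] /axis_contracting_set[C2 c2] [rho rho0 ind].
pose C := Num.max C1 C2.
have cg : contracting_set C (axis act o g).
  by apply: contracting_setW c1; rewrite le_max lexx.
have ch : contracting_set C (axis act o h).
  by apply: contracting_setW c2; rewrite le_max lexx orbT.
have [C_ge1 pg _] := cg; have [_ ph _] := ch.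
have r0 : 0 <= 24 * C by lra.
exists (Num.max C (rho (24 * C))); first by rewrite le_max rho0 ?orbT.
move=> z p hz np; rewrite le_max.
apply/orP; have [|far] := leP (mdist p o) C; [by left|right].
have [c [gc c0 cL]] := geodesic_between Xgeo z o.
have no : nearest (axis act o g) (c (mdist z o)) o.
  by rewrite cL; split=> [|y _]; [exact: axis_base|rewrite mdistxx mdist_ge0].
rewrite -c0 in np.
have [u u0 up] := pass_near Xgeo cg gc np no far.
have [q nq] := ph (c u).
have uq : mdist (c u) q <= 16 * C.
  apply: (quasi_convex Xgeo ch gc u0) nq; rewrite ?c0 ?cL//.
  exact: axis_base.
have /(le_diamP _ (rho0 _ r0)) := ind _ r0; apply.
  split; first by apply: (closed_nbhdW np.1); rewrite mdistxx.
  apply: (closed_nbhdW nq.1); have := mdistD (c u) p q.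
  by rewrite (metric_sym p (c u)); lra.
by split; apply: (closed_nbhdW (axis_base _)); rewrite mdistxx.
Qed.

Section Family.
Variables (h : G) (C tau : R) (u : nat -> G).
Hypothesis qh : qi_embedding_int (orb h).
Hypothesis ch : contracting_set C (axis act o h).
Hypothesis tau_ge0 : 0 <= tau.
Hypothesis two_axes : forall i j z p q, i != j ->
  nearest (translate act (u i) (axis act o h)) z p ->
  nearest (translate act (u j) (axis act o h)) z q ->
  mdist p (act (u i) o) <= tau \/ mdist q (act (u j) o) <= tau.

(** Translates of the axis of [s] are taut with the same constant, so three exceptional indices
    would contradict [no_three_far], with [T] independent of [v]. *)
Lemma few_far s : contracting_element act o s ->
  exists2 T, 0 <= T & forall v m,
    (count (fun i => `[< ~ casts_near act o h s T ((u i)^-1 * v)%g >])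
       (iota 0 m) <= 2)%N.
Proof.
move=> cs; have qs := cs.2; have [C' cs'] := axis_contracting_set cs.
have [K tK] := qi_taut Xgeo qs cs'.
have [C1 _ _] := ch; have tau0 := tau_ge0.
have K0 : 0 <= K by have := tK 0 0 0 (lexx _) (lexx _); rewrite mdistxx; lra.
exists (5 * tau + 2 * K + 64 * C); first by lra.
set T := 5 * tau + 2 * K + 64 * C => v m.
apply: count_le2; first exact: iota_uniq.
pose f n := act v (orb s n).
have tf : taut K f by move=> *; rewrite !(mdist_act act_iso); exact: tK.
have far i : ~ casts_near act o h s T ((u i)^-1 * v)%g -> exists n p,
    nearest (translate act (u i) (axis act o h)) (f n) p /\
    T < mdist p (act (u i) o).
  move=> /existsNP[n /existsNP[p /not_implyP[np /negP]]].
  rewrite -ltNge => far; exists n, (act (u i) p); split.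
    apply/(nearest_translate act_iso).
    by rewrite (actK act_iso) /f -(actM act_iso _ v).
  by rewrite (mdist_act act_iso).
move=> i j k ij jk ik /asboolP/far[l [p [np pT]]] /asboolP/far[m' [q [nq qT]]].
move=> /asboolP/far[n [r [nr rT]]].
have := no_three_far Xgeo
  (fun i => contracting_set_translate act_iso (u i) ch) tf tau0 two_axes
  ij jk ik np nq nr.
by rewrite -/T; case; rewrite leNgt ?pT ?qT ?rT.
Qed.

Lemma exists_long r : exists N : nat, r < mdist o (act (h ^+ N)%g o).
Proof.
have [N hN] := qi_proper r qh; exists N.+1; rewrite ltNge; apply/negP => le.
have := hN 0 N.+1%:Z; rewrite {1}/orb /= (act1 act_iso) => /(_ le); lia.
Qed.

Lemma small_noncontracting :
  contracting_element act o h ->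
  small [set x | ~ forall o', contracting_element act o' x].
Proof.
move=> hc; have [T T0 few] := few_far hc.
have [N /ltW hN] := exists_long (20 * (T + 4 * C)).
apply: (@small_of_pairs _ _ (fun i j => u i * h ^+ N * (u j)^-1)%g) => a b.
(* For fixed [i] the first condition is that of [few_far] in [j]; for fixed [j] the second is so in
   [i]. *)
exists (fun i j =>
  `[< ~ casts_near act o h h T ((u j)^-1 * (b * a * u i))%g >]).
exists (fun i j =>
  `[< ~ casts_near act o h h T ((u i)^-1 * (a^-1 * b^-1 * u j))%g >]).
split=> [i m|j m|i j /= nc]; [exact: few|exact: few|].
apply: contrapT => /negP; rewrite negb_or.
move=> /andP[/asboolP/contrapT n1 /asboolP/contrapT n2].
apply: nc => o'; set w := ((u j)^-1 * (b * a * u i))%g in n1.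
have -> : (a * (u i * h ^+ N * (u j)^-1) * b
    = (a * u i) * (h ^+ N * w) * (a * u i)^-1)%g.
  by rewrite /w invgM !mulgA !mulgK.
apply: (contracting_conj act_iso).
apply: (chain_contracting act_iso Xgeo ch T0 n1 _ hN).
suff -> : w^-1%g = ((u i)^-1 * (a^-1 * b^-1 * u j))%g by [].
by rewrite /w !invgM invgK !mulgA.
Qed.

(** Outside the bad pairs, the axis of [s] and its translate by [x] project near two far apart
    points of a translate of the axis of [h]; by [separated_shadows] they are close to each other
    only in a bounded region. *)
Lemma small_dependent s : contracting_element act o s ->
  small [set x | ~ weakly_independent act o s (x * s * x^-1)%g].
Proof.
move=> cs; have [T T0 few] := few_far cs; have [C1 _ _] := ch.
have [N hN] := exists_long (2 * T + C).
apply: (@small_of_pairs _ _ (fun i j => u i * h ^+ N * (u j)^-1)%g) => a b.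
exists (fun i j => `[< ~ casts_near act o h s T ((u j)^-1 * b)%g >]).
exists (fun i j => `[< ~ casts_near act o h s T ((u i)^-1 * a^-1)%g >]).
split=> [i m|j m|i j /= nd]; [exact: few|exact: few|].
apply: contrapT => /negP; rewrite negb_or.
move=> /andP[/asboolP/contrapT n1 /asboolP/contrapT n2].
apply: nd; set x := (a * (u i * h ^+ N * (u j)^-1) * b)%g.
pose c := (a * u i)%g; pose Y := translate act c (axis act o h).
have cY : contracting_set C Y by exact: contracting_set_translate.
have cV : c^-1%g = ((u i)^-1 * a^-1)%g by rewrite /c invgM.
have near1 n p : nearest Y (orb s n) p -> mdist p (act c o) <= T.
  move=> /(nearest_translate act_iso); rewrite cV => /n2.
  by rewrite -cV (mdist_actV act_iso).
have xE y : act x y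
    = act c (act (zexpg h N%:Z) (act ((u j)^-1 * b)%g y)).
  by rewrite -!(actM act_iso) /x /c !mulgA.
have near2 n p : nearest Y (act x (orb s n)) p ->
    mdist p (act c (act (zexpg h N%:Z) o)) <= T.
  move=> /(nearest_translate act_iso) /(nearest_orbit act_iso (- N%:Z)).
  by rewrite xE zexpgN !(actK act_iso) -!(mdist_actV act_iso) => /n1.
have apart : 2 * T + C < mdist (act c o) (act c (act (zexpg h N%:Z) o)).
  by rewrite (mdist_act act_iso).
(* The axis of the conjugate stays within [delta] of the translate by [x] of the axis of [s]. *)
pose delta := mdist o (act x^-1%g o).
have delta0 : 0 <= delta by exact: mdist_ge0.
(* Half of this bounds the distance from a common point to [act c o]: [r + 1] to the axis of [s],
   then [separated_shadows]. *)
pose rho r := 2 * ((r + 1) + (2 * (r + 1) + delta) + 32 * C + T).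
have rho0 r : 0 <= r -> 0 <= rho r by move=> r0; rewrite /rho; lra.
exists rho => // r r0; apply/(le_diamP _ (rho0 _ r0)).
suff close z : (closed_nbhd r (axis act o s) `&`
    closed_nbhd r (axis act o (x * s * x^-1)%g)) z ->
    mdist z (act c o) <= rho r / 2.
  move=> z z' /close h1 /close h2; have := mdistD (act c o) z z'.
  by rewrite (metric_sym (act c o)); lra.
move=> [/closed_nbhd_ex [_ [m _ <-] zm] /closed_nbhd_ex [_ [n _ <-] zn]].
rewrite zexpg_conj in zn.
have d : mdist (act (x * zexpg s n * x^-1)%g o) (act x (orb s n)) = delta.
  by rewrite !(actM act_iso) !(mdist_act act_iso) metric_sym.
have [_ pY _] := cY; have [p np] := pY (orb s m).
have [q nq] := pY (act x (orb s n)).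
have := separated_shadows Xgeo cY np nq (near1 _ _ np) (near2 _ _ nq) apart.
have := mdistD (orb s m) z (act c o).
have := mdistD z (orb s m) (act x (orb s n)).
have := mdistD (act (x * zexpg s n * x^-1)%g o) z (act x (orb s n)).
move: zm zn; rewrite d (metric_sym z (orb s m)) -/(orb s m) /rho; lra.
Qed.

End Family.

(* The axis of [g] serves as a ruler: a point that projects far from [u i o] on
   the translate by [u i] of the axis of [h] projects near [u i o] on the axis
   of [g], which can happen for one [i] only. *)
Lemma exists_axis_family : contracting_property act o ->
  exists h C tau (u : nat -> G), [/\ contracting_element act o h,
    contracting_set C (axis act o h), 0 <= tau & forall i j z p q, i != j ->
      nearest (translate act (u i) (axis act o h)) z p ->
      nearest (translate act (u j) (axis act o h)) z q ->
      mdist p (act (u i) o) <= tau \/ mdist q (act (u j) o) <= tau].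
Proof.
move=> [g [h [cg ch gh]]].
have [C1 c1] := axis_contracting_set cg.
have [C2 c2] := axis_contracting_set ch.
pose C := Num.max C1 C2.
have {}c1 : contracting_set C (axis act o g).
  by apply: contracting_setW c1; rewrite le_max lexx.
have {}c2 : contracting_set C (axis act o h).
  by apply: contracting_setW c2; rewrite le_max lexx orbT.
have [C_ge1 pg _] := c1.
have [t1 t10 s1] := independent_shadow cg ch gh.
have [t2 t20 s2] := independent_shadow ch cg (weakly_independent_sym gh).
pose t := Num.max t1 t2.
have t1t : t1 <= t by rewrite le_max lexx.
have t2t : t2 <= t by rewrite le_max lexx orbT.
have [M hM] := qi_proper (2 * (t + 4 * C)) cg.2.
(* Exponents that are multiples of [M + 1] keep the points [act (u i) o] more than [2 * (t + 4 * C)]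
   apart. *)
pose u i := zexpg g (i * M.+1)%:Z.
exists h, C, (t + C), u; split=> //; first by lra.
have key i z p y : nearest (translate act (u i) (axis act o h)) z p ->
    t + C < mdist p (act (u i) o) -> nearest (axis act o g) z y ->
    mdist y (act (u i) o) <= t + 4 * C.
  move=> np far ny.
  have cu := contracting_set_translate act_iso (u i) c2.
  apply: (shadow_transfer Xgeo c1 cu _ _ np far ny).
    move=> w p' hw /(nearest_orbit act_iso (- (i * M.+1)%:Z)) np'.
    rewrite zexpgN in np'.
    by apply: le_trans t1t; rewrite -(mdist_actV act_iso); exact: s1 hw np'.
  move=> w p' gw /(nearest_translate act_iso) np'.
  rewrite -(mdist_actV act_iso); apply: le_trans t2t; apply: s2 np'.
  case: gw => n _ <-; rewrite /u -zexpgN; exact: orbitS.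
move=> i j z p q ij np nq.
have [?|fp] := leP (mdist p (act (u i) o)) (t + C); first by left.
have [?|fq] := leP (mdist q (act (u j) o)) (t + C); first by right.
exfalso; have [y ny] := pg z.
have h1 := key _ _ _ _ np fp ny; have h2 := key _ _ _ _ nq fq ny.
have : mdist (act (u i) o) (act (u j) o) <= 2 * (t + 4 * C).
  have := mdistD y (act (u i) o) (act (u j) o).
  by rewrite (metric_sym _ y); lra.
move=> /hM; clear -ij => bound.
have : (i * M.+1 != j * M.+1)%N by rewrite eqn_pmul2r.
have [lt|gt|->] := ltngtP i j; last by rewrite eqxx.
- have : (i.+1 * M.+1 <= j * M.+1)%N by rewrite leq_mul2r lt orbT.
  rewrite mulSn; lia.
- have : (j.+1 * M.+1 <= i * M.+1)%N by rewrite leq_mul2r gt orbT.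
  rewrite mulSn; lia.
Qed.

Theorem one_space_small : contracting_property act o ->
  small [set x | ~ forall o', contracting_element act o' x] /\
  forall s, contracting_element act o s ->
    small [set x | ~ weakly_independent act o s (x * s * x^-1)%g].
Proof.
move=> /exists_axis_family[h [C [tau [u [hc cC tau0 two]]]]]; split.
  exact: (small_noncontracting hc.2 cC tau0 two hc).
move=> s cs; exact: (small_dependent hc.2 cC tau0 two cs).
Qed.

(** The intersection contains the whole orbit, which is unbounded. This makes the final sequence of
    conjugates injective. *)
Lemma weakly_dependent_self s : contracting_element act o s ->
  ~ weakly_independent act o s s.
Proof.
move=> cs [rho rho0 /(_ 0 (lexx _))/(le_diamP _ (rho0 _ (lexx _))) bound].
have [N hN] := qi_proper (rho 0) cs.2.
have mem n :
    (closed_nbhd 0 (axis act o s) `&` closed_nbhd 0 (axis act o s)) (orb s n).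
  by split; apply: (@closed_nbhdW _ _ _ _ _ (orb s n));
    rewrite ?mdistxx//; exists n.
have := hN 0 N.+1%:Z (bound _ _ (mem _) (mem _)); lia.
Qed.

End OneSpace.

(** * Density in word balls *)

Section Words.
Context {G : groupType}.
Implicit Types (S : set G) (x y g : G).
Local Open Scope group_scope.

Lemma word_ball_le S (m n : nat) g : (m <= n)%N -> word_ball S m g ->
  word_ball S n g.
Proof.
by move=> mn [w [sw lw ->]]; exists w; split=> //; exact: leq_trans mn.
Qed.

Lemma word_ball1 S n : word_ball S n 1.
Proof. by exists [::]; rewrite big_nil. Qed.

Lemma word_ballM S (m n : nat) x y : word_ball S m x -> word_ball S n y ->
  word_ball S (m + n) (x * y).
Proof.
move=> [v [sv lv ->]] [w [sw lw ->]]; exists (v ++ w); split.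
- by rewrite size_cat leq_add.
- by move=> z; rewrite mem_cat => /orP[/lv|/lw].
- by rewrite big_cat.
Qed.

Lemma letters_inv S x : letters S x -> letters S x^-1.
Proof.
by case=> [Sx|[y Sy <-]]; [right; exists x|left; rewrite invgK].
Qed.

Lemma word_ball_letter S x : letters S x -> word_ball S 1 x.
Proof.
move=> lx; exists [:: x].
by split=> // [y|]; rewrite ?big_seq1// inE => /eqP ->.
Qed.

Lemma word_ballV S n x : word_ball S n x -> word_ball S n x^-1.
Proof.
move=> [w [sw lw ->]]; apply: (word_ball_le sw).
elim: w lw {sw} => [|z w IH] lw.
  by rewrite big_nil invg1; exact: word_ball1.
rewrite big_cons invgM /= -addn1; apply: word_ballM.
  by apply: IH => y yw; apply: lw; rewrite inE yw orbT.
by apply/word_ball_letter/letters_inv/lw; rewrite mem_head.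
Qed.

Lemma word_ball_split S (m n : nat) g : word_ball S (m + n) g ->
  exists x y, [/\ word_ball S m x, word_ball S n y & g = x * y].
Proof.
move=> [w [sw lw ->]].
exists (\prod_(x <- take m w) x), (\prod_(x <- drop m w) x).
split; last by rewrite -big_cat cat_take_drop.
- exists (take m w); split=> // [|x /mem_take]; last exact: lw.
  by rewrite size_take_min geq_minl.
- exists (drop m w); split=> // [|x /mem_drop]; last exact: lw.
  by rewrite size_drop leq_subLR.
Qed.

Lemma generates_word_ball S g : generates S -> exists n, word_ball S n g.
Proof.
move=> gS; have : [set: G] g by [].
rewrite -gS; apply: (@smallest_sub _ _ _ [set g | exists n, word_ball S n g]).
  split; first by rewrite inE; exists 0%N; exact: word_ball1.
  move=> x y; rewrite !inE => -[m xm] [n yn]; exists (m + n)%N.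
  by apply: word_ballM => //; exact: word_ballV.
by move=> x Sx; exists 1%N; apply: word_ball_letter; left.
Qed.

Lemma generates_word_ball_seq S (P : seq G) : generates S ->
  exists n, forall g, g \in P -> word_ball S n g.
Proof.
move=> gS; elim: P => [|x P [n hn]]; first by exists 0%N.
have [m xm] := generates_word_ball x gS; exists (m + n)%N => g.
rewrite inE => /orP[/eqP ->|/hn]; first exact: (word_ball_le (leq_addr _ _) xm).
by apply: word_ball_le; exact: leq_addl.
Qed.

Lemma card_cover (A B : set G) (P : seq G) (f : G -> G -> G) :
  finite_set A -> finite_set B ->
  (forall x, A x -> exists y p, [/\ B y, p \in P & x = f y p]) ->
  (#|` fset_set A| <= #|` fset_set B| * size P)%N.
Proof.
move=> fA fB cov; rewrite -(size_allpairs f); apply: uniq_leq_size.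
  exact: fset_uniq.
move=> x; rewrite in_fset_set// inE => /cov[y [p [By pP ->]]].
by apply/allpairsP; exists (y, p); split=> //=; rewrite in_fset_set// inE.
Qed.

(** If [P] lies in the ball of radius [D], each [x] in the ball of radius [n - D] gives some [x * p]
    in [A] and in the ball of radius [n]. The latter ball is larger than the former by at most the
    factor given by the ball of radius [D]. *)
Lemma positive_density (R : realType) S (A : set G) (P : seq G) :
  finite_set S -> generates S -> (0 < size P)%N ->
  (forall a, exists2 p, p \in P & A (a * p)) ->
  exists c : R, (0 < c < 1)%R /\
    \forall n \near \oo,
      (c < #|` fset_set (word_ball S n `&` A)|%:R
            / #|` fset_set (word_ball S n)|%:R)%R.
Proof.
move=> fS gS P0 hP; have [D hD] := generates_word_ball_seq P gS.
have fb n : finite_set (word_ball S n) by exact: finite_word_ball.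
have b0 n : (0 < #|` fset_set (word_ball S n)|)%N.
  by rewrite cardfs_gt0; apply/fset0Pn; exists 1; rewrite in_fset_set// inE;
    exact: word_ball1.
pose K := (size P * #|` fset_set (word_ball S D)|)%N.
have K0 : (0 < K)%N by rewrite muln_gt0 P0 b0.
have K1 : (1 <= K%:R :> R)%R by rewrite ler1n.
(* The factor 2 gives the strict inequality and a constant below 1. *)
exists (2 * K%:R)^-1%R; split.
  by rewrite invr_gt0 invf_lt1; lra.
exists D => // n /= Dn; rewrite -(subnK Dn); set m := (n - D)%N.
set E := word_ball S (m + D) `&` A.
have fE : finite_set E by exact: finite_setIl.
have h1 : (#|` fset_set (word_ball S m)| <= #|` fset_set E| * size P)%N.
  apply: (@card_cover _ _ _ (fun y p => y * p^-1)) => // x xm.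
  have [p pP Axp] := hP x; exists (x * p), p; split=> //; last by rewrite mulgK.
  by split=> //; apply: word_ballM => //; exact: hD.
have h2 : (#|` fset_set (word_ball S (m + D))| <=
    #|` fset_set (word_ball S m)| * size (fset_set (word_ball S D)))%N.
  apply: (@card_cover _ _ _ *%g) => // x /word_ball_split[y [z [ym zD ->]]].
  by exists y, z; split=> //; rewrite in_fset_set// inE.
have h3 : (#|` fset_set (word_ball S (m + D))| <= K * #|` fset_set E|)%N.
  by apply: (leq_trans h2); rewrite /K mulnAC (mulnC (size P)) leq_mul.
have bR : (0 < #|` fset_set (word_ball S (m + D))|%:R :> R)%R by rewrite ltr0n.
move: h3; rewrite -(ler_nat R) natrM => h3.
rewrite ltr_pdivlMr// ltr_pdivrMl; lra.
Qed.

End Words.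

(** * Several actions at once *)

Theorem theorem1p4 (R : realType) (l : nat) (G : groupType)
    (X : 'I_l -> metricType R) (o : forall i, X i)
    (act : forall i, G -> X i -> X i)
    (l_ge1 : (1 <= l)%N)
    (X_geodesic : forall i, geodesic_space (X i))
    (act_isometric : forall i, isometric_action (act i))
    (act_contracting : forall i, contracting_property (act i) (o i)) :
  (SC act o !=set0 /\
   exists F : set G, infinite_set F /\ independent act o F) /\
  (forall S : set G, finite_set S -> generates S ->
    exists c : R, (0 < c < 1) /\
      \forall n \near \oo,
        c < #|` fset_set (word_ball S n `&` SC act o)|%:R
              / #|` fset_set (word_ball S n)|%:R).
Proof.
have small1 i :=
  one_space_small (act_isometric i) (X_geodesic i) (act_contracting i).
(* Quantifying over base points makes this invariant under conjugation. *)
pose strong x := forall i o', contracting_element (act i) o' x.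
have strong_SC x : strong x -> SC act o x by move=> sx i; exact: sx.
have [P P0 hP] : exists2 P : seq G, (0 < size P)%N &
    forall a, exists2 p, p \in P & strong (a * p)%g.
  have sm := small_bigU (s := enum 'I_l) (fun i _ => (small1 i).1).
  have [P P0 hP] := small_escape sm; exists P => // a.
  have [p pP np] := hP a; exists p => // i o'; apply: contrapT => nc.
  by apply: np; exists i; [rewrite mem_enum|move=> /(_ o')].
split; last first.
  move=> S fS gS; apply: (positive_density R fS gS P0) => a.
  by have [p pP /strong_SC ?] := hP a; exists p.
have [p _ ss] := hP 1%g; rewrite mul1g in ss; set s := p in ss.
split; first by exists s; exact: strong_SC.
pose t u : G := (u * s * u^-1)%g.
have st u : strong (t u) by move=> i o'; apply: contracting_conj.
have /choice[ch chP] : forall L : seq G, exists u, forall v, v \in L ->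
    forall i, weakly_independent (act i) (o i) (t v) (t u).
  move=> L.
  have sm v i : small [set u | ~ weakly_independent (act i) (o i) (t v) (t u)].
    (* Here [t u] is the conjugate of [t v] by [u * v^-1]. *)
    have := small_translate v^-1%g ((small1 i).2 _ (st v i (o i))).
    apply: small_sub => u; rewrite /= /t invgM invgK => h h'; apply: h.
    by move: h'; rewrite !mulgA !mulgVK.
  have sm2 := small_bigU (s := L)
    (fun v _ => small_bigU (s := enum 'I_l) (fun i _ => sm v i)).
  have [Q _ /(_ 1%g)[u _ nu]] := small_escape sm2; exists u => v vL i.
  apply: contrapT => nw; apply: nu; exists v => //.
  exists i; first by rewrite mem_enum.
  by rewrite /= mul1g.
(* Each new conjugator is chosen against all the previous ones. *)
pose L n := iter n (fun L => ch L :: L) [::].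
have memL m n : (m < n)%N -> ch (L m) \in L n.
  elim: n => // n IH; rewrite ltnS leq_eqVlt inE => /orP[/eqP ->|/IH ->].
    by rewrite eqxx.
  by rewrite orbT.
pose f n := t (ch (L n)).
have ind m n i : m != n -> weakly_independent (act i) (o i) (f m) (f n).
  case: ltngtP => // mn _; first by apply: chP; exact: memL.
  by apply: weakly_independent_sym; apply: chP; exact: memL.
have f_inj : injective f.
  (* The condition [1 <= l] provides a space in which to compare equal terms. *)
  move=> m n fmn; apply/eqP; apply: contrapT => /negP/(ind _ _ (Ordinal l_ge1)).
  by rewrite -fmn; apply: weakly_dependent_self => //; exact: st.
exists (range f); split.
  move=> /finite_preimage fin; apply: infinite_nat.
  have -> : [set: nat] = f @^-1` range f.
    by apply/seteqP; split=> // n _; exists n.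
  by apply: fin => m n _ _; exact: f_inj.
split=> [_ [n _ <-]|_ _ [m _ <-] [n _ <-] mn i]; first exact/strong_SC/st.
by apply: ind; apply/eqP => e; apply: mn; rewrite e.
Qed.
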